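(* Let $A\in\mathbb{R}^{n\times d}$, and let $u^\star\in\mathbb{R}^d$ be the true parameter generating the data via $y=Au^\star+\varepsilon$ with noise $\varepsilon\in\mathbb{R}^n$. Let $\mathcal{M}\subset\mathbb{R}^d$ be a linear subspace and let $\mathsf{R}_\eta$, $\eta>0$, be a family of regularizers that is approximately decomposable with respect to $\mathcal{M}$, with associated norm $\mathsf{R}$ and functions $c_i^L,c_i^U$, $i=1,2$ (see context). Let $\lambda>0$, let $\eta>0$ be small enough that $c_1^L(\eta)<\tfrac14$, and let $\hat u$ be the minimizer over $u\in\mathbb{R}^d$ of $$\mathsf{F}(u)=\frac{1}{2n}\|y-Au\|_2^2+\lambda\,\mathsf{R}_\eta(u).$$ Assume that $A$ satisfies the restricted strong convexity (RSC) condition for $\mathsf{R}$ with curvature $\kappa$ and tolerance $\tau^2$. Then, if $\tau\,\Psi(\mathcal{M})\le \frac{\sqrt{\kappa}}{32}$ and $\lambda\ge 2\,\mathsf{R}^*\!\left(\frac1n A^T\varepsilon\right)$, $$\|\hat u-u^\star\|_2^2\lesssim \frac{\lambda^2}{\kappa^2}\Psi^2(\mathcal{M})+\frac{\tau^2}{\kappa}\mathsf{R}(u^\star_{\mathcal{M}^\perp})^2+\frac{\lambda}{\kappa}\mathsf{R}(u^\star_{\mathcal{M}^\perp})+\mathcal{E}_\eta,$$ where $$\mathcal{E}_\eta:=\frac{\tau^2}{\kappa}\Bigl(c_1(\eta)^2\mathsf{R}(u^\star_{\mathcal{M}})^2+c_2(\eta)^2\Bigr)+\frac{\lambda}{\kappa}\Bigl(c_1(\eta)\mathsf{R}(u^\star_{\mathcal{M}})+c_2(\eta)\Bigr),\qquad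 c_i(\eta):=c_i^L(\eta)+c_i^U(\eta),\ i=1,2.$$
   Context: A norm $\mathsf{R}$ on $\mathbb{R}^d$ is decomposable with respect to a linear subspace $\mathcal{M}$ if $\mathsf{R}(u+v)=\mathsf{R}(u)+\mathsf{R}(v)$ for all $u\in\mathcal{M}$, $v\in\mathcal{M}^\perp$, where $\mathcal{M}^\perp$ is the Euclidean orthogonal complement. A family of regularizers $\mathsf{R}_\eta:\mathbb{R}^d\to\mathbb{R}^+$, $\eta>0$, is approximately decomposable with respect to $\mathcal{M}$ if there exist a norm $\mathsf{R}$ decomposable with respect to $\mathcal{M}$ and non-negative functions $c_i^L(\eta),c_i^U(\eta)$, $i=1,2$, all tending to $0$ as $\eta\to0$, such that for every $u\in\mathbb{R}^d$ $$(1-c_1^L(\eta))\mathsf{R}(u)-c_2^L(\eta)\le \mathsf{R}_\eta(u)\le (1+c_1^U(\eta))\mathsf{R}(u)+c_2^U(\eta).$$ Dual norm: $\mathsf{R}^*(u):=\sup_{\mathsf{R}(v)\le1}\langle u,v\rangle$. For $u\in\mathbb{R}^d$, $u_{\mathcal{M}}$ and $u_{\mathcal{M}^\perp}$ denote the Euclidean projections of $u$ onto $\mathcal{M}$ and $\mathcal{M}^\perp$. Subspace Lipschitz constant: $\Psi(\mathcal{M}):=\sup_{u\in\mathcal{M}\setminus\{0\}}\mathsf{R}(u)/\|u\|_2$. RSC condition for $\mathsf{R}$ with curvature $\kappa$ and tolerance $\tau^2$: $\frac{\|A\Delta\|_2^2}{2n}\ge\frac{\kappa}{2}\|\Delta\|_2^2-\tau^2\mathsf{R}^2(\Delta)$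 for all $\Delta\in\mathbb{R}^d$. The relation $a\lesssim b$ means $a\le Cb$ for a universal constant $C>0$. The bound is deterministic: no specific distributional assumption on the noise or the forward map is used.
   Formalization: The constant in ≲ is not universal: for each B there is a constant depending only on B, valid whenever c_1^U(η) ≤ B. With a universal constant the claim fails when c_1^U(η) is large. *)

(* Defs.v *)
From HB Require Import structures.
From mathcomp Require Import all_boot all_order all_algebra.
From mathcomp Require Import all_classical all_reals all_analysis.

Set Implicit Arguments.
Unset Strict Implicit.
Unset Printing Implicit Defensive.

Import Order.TTheory GRing.Theory Num.Theory.
Import numFieldNormedType.Exports.

Local Open Scope ring_scope.
Local Open Scope classical_set_scope.

Section Euclidean.
Context {R : realType} {d : nat}.
Implicit Types (u v w : 'cV[R]_d) (M : {vspace 'cV[R]_d}).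

Definition dot u v : R := \sum_(i < d) u i 0 * v i 0.

(* The norm `|u| that the library puts on matrices is the sup norm. *)
Definition norm2 u : R := Num.sqrt (dot u u).

Lemma dotC u v : dot u v = dot v u.
Proof. by apply: eq_bigr => i _; rewrite mulrC. Qed.

Lemma dotDl u v w : dot (u + v) w = dot u w + dot v w.
Proof. by rewrite -big_split; apply: eq_bigr => i _; rewrite !mxE mulrDl. Qed.

Lemma dotZl a u v : dot (a *: u) v = a * dot u v.
Proof. by rewrite mulr_sumr; apply: eq_bigr => i _; rewrite mxE mulrA. Qed.

Lemma dot_eq0 u : dot u u = 0 -> u = 0.
Proof.
move=> /eqP; rewrite psumr_eq0 => [/allP u0|i _]; last exact: sqr_ge0.
apply/colP => i; have := u0 i (mem_index_enum i).
by rewrite mulf_eq0 orbb mxE => /eqP.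
Qed.

Lemma dot_linearl v : linear_for *%R (dot^~ v).
Proof. by move=> a u w; rewrite dotDl dotZl. Qed.

Lemma dot_linearr u : linear_for *%R (dot u).
Proof. by move=> a v w; rewrite !(dotC u) dotDl dotZl. Qed.

HB.instance Definition _ :=
  @bilinear_isBilinear.Build R 'cV[R]_d 'cV[R]_d R *%R (idfun \; *%R) dot
    (dot_linearl, dot_linearr).

Lemma dot_hermitian u v : dot u v = (-1) ^+ false * idfun (dot v u).
Proof. by rewrite expr0 mul1r /= dotC. Qed.

HB.instance Definition _ :=
  @isHermitianSesquilinear.Build R 'cV[R]_d false idfun dot dot_hermitian.

Definition orth M : {vspace 'cV[R]_d} := orthov dot M.

Definition eproj M : 'cV[R]_d -> 'cV[R]_d := daddv_pi M (orth M).

Lemma mem_orthP M v : reflect {in M, forall u, dot v u = 0} (v \in orth M).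
Proof. exact: mem_orthovP. Qed.

Lemma cap_orth M : (M :&: orth M = 0)%VS.
Proof.
apply/eqP; rewrite -subv0; apply/subvP => u; rewrite memv_cap memv0.
by case/andP=> uM /mem_orthP/(_ u uM)/dot_eq0 ->.
Qed.

Lemma add_orth M : (M + orth M = fullv)%VS.
Proof.
pose g v : 'rV[R]_(\dim M) := \row_i dot v (vbasis M)`_i.
have g_lin : linear g by move=> a v w; apply/rowP => i; rewrite !mxE dotDl dotZl.
pose gL := GRing.isLinear.Build _ _ _ _ g g_lin.
pose G : {linear 'cV[R]_d -> 'rV[R]_(\dim M)} := HB.pack g gL.
have kerG : (lker (linfun G) <= orth M)%VS.
  apply/subvP => v; rewrite memv_ker lfunE /= => /eqP/rowP gv0.
  apply/mem_orthP => u /coord_vbasis ->.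
  rewrite linear_sumr big1// => i _; rewrite linearZr /=.
  by have := gv0 i; rewrite !mxE => ->; rewrite mulr0.
apply/eqP; rewrite eqEdim subvf /= dimv_disjoint_sum ?cap_orth//.
rewrite -(limg_ker_dim (linfun G) fullv) capfv addnC leq_add ?(dimvS kerG)//.
by rewrite (leq_trans (dimvS (subvf _)))// dimvf /dim /= mul1n.
Qed.

Lemma dim_orth M : (\dim M + \dim (orth M))%N = \dim {:'cV[R]_d}.
Proof. by rewrite -dimv_disjoint_sum ?cap_orth ?add_orth. Qed.

Lemma orthK M : orth (orth M) = M.
Proof.
have sub N : (N <= orth (orth N))%VS.
  by apply/subvP => u uN; apply/mem_orthP => v /mem_orthP vN; rewrite dotC vN.
apply/esym/eqP; rewrite eqEdim sub -(leq_add2l (\dim (orth M))).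
by rewrite dim_orth addnC dim_orth leqnn.
Qed.

Lemma eproj_mem M u : eproj M u \in M.
Proof. exact: memv_pi. Qed.

Lemma eproj_decomp M u : u = eproj M u + eproj (orth M) u.
Proof.
by rewrite /eproj orthK daddv_pi_add ?cap_orth// add_orth memvf.
Qed.

Lemma eproj_orth M u : u - eproj M u \in orth M.
Proof. by rewrite {1}(eproj_decomp M u) addrC addKr eproj_mem. Qed.

Definition is_norm (N : 'cV[R]_d -> R) : Prop :=
  [/\ forall u v, N (u + v) <= N u + N v,
      forall a u, N (a *: u) = `|a| * N u
    & forall u, N u = 0 -> u = 0].

Definition decomposable (N : 'cV[R]_d -> R) M : Prop :=
  {in M & orth M, forall u v, N (u + v) = N u + N v}.

(* Only the values at eta > 0 of Reg and of the four functions matter. *)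
Definition approx_decomposable (Reg : R -> 'cV[R]_d -> R) M
    (N : 'cV[R]_d -> R) (c1L c2L c1U c2U : R -> R) : Prop :=
  [/\ forall eta u, 0 < eta -> 0 <= Reg eta u,
      is_norm N /\ decomposable N M,
      forall eta, 0 < eta ->
        [/\ 0 <= c1L eta, 0 <= c2L eta, 0 <= c1U eta & 0 <= c2U eta],
      [/\ c1L @ 0^'+ --> 0, c2L @ 0^'+ --> 0,
          c1U @ 0^'+ --> 0 & c2U @ 0^'+ --> 0]
    & forall eta u, 0 < eta ->
        (1 - c1L eta) * N u - c2L eta <= Reg eta u
          <= (1 + c1U eta) * N u + c2U eta].

(* When N is a norm, the sets of which dual_norm and sub_lip take the supremum
   are bounded above. They are nonempty, except the second one for M = 0, where
   sub_lip N M = sup set0 = 0. *)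
Definition dual_norm (N : 'cV[R]_d -> R) u : R :=
  sup [set dot u v | v in [set v | N v <= 1]].

Definition sub_lip (N : 'cV[R]_d -> R) M : R :=
  sup [set N u / norm2 u | u in [set u | u \in M /\ u != 0]].

End Euclidean.

Definition objective {R : realType} {n d : nat} (A : 'M[R]_(n, d))
    (y : 'cV[R]_n) (lambda : R) (reg : 'cV[R]_d -> R) (u : 'cV[R]_d) : R :=
  norm2 (y - A *m u) ^+ 2 / (2 * n%:R) + lambda * reg u.

(* The tolerance of the condition is tau ^+ 2. *)
Definition RSC {R : realType} {n d : nat} (A : 'M[R]_(n, d))
    (N : 'cV[R]_d -> R) (kappa tau : R) : Prop :=
  forall Delta : 'cV[R]_d,
    kappa / 2 * norm2 Delta ^+ 2 - tau ^+ 2 * N Delta ^+ 2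
      <= norm2 (A *m Delta) ^+ 2 / (2 * n%:R).

(* Main.v *)
(** Put Delta = uhat - ustar, a = N (Delta_M), b = N (Delta_Mperp) and
    q = N (ustar_Mperp), p = N (ustar_M). Comparing the objective at uhat and at
    ustar, Hoelder's inequality for the dual norm and the approximate
    decomposability give
      0 <= |A Delta|^2 / 2n <= lambda (3/2 a - b/4 + K),
    with K = (2 + |B|) q + c1 p + c2. Hence b <= 6 a + 4 K (a cone condition up to
    slack) and N Delta <= 7 Psi |Delta| + 4 K. Inserting this in the RSC
    inequality, tau Psi <= sqrt kappa / 32 makes the quadratic term in |Delta|
    small enough to be absorbed by kappa/2 |Delta|^2. *)

Require Import Defs.
From mathcomp Require Import all_boot all_order all_algebra.
From mathcomp Require Import all_classical all_reals all_analysis.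
From mathcomp Require Import ring lra.

Set Implicit Arguments.
Unset Strict Implicit.
Unset Printing Implicit Defensive.

Import Order.TTheory GRing.Theory Num.Theory.
Import numFieldNormedType.Exports.

Local Open Scope ring_scope.
Local Open Scope classical_set_scope.

(** * Euclidean norm, adjoint and orthogonal projection *)

Lemma norm2_ge0 (R : realType) (d : nat) (u : 'cV[R]_d) : 0 <= norm2 u.
Proof. exact: sqrtr_ge0. Qed.

Lemma dot_ge0 (R : realType) (d : nat) (u : 'cV[R]_d) : 0 <= dot u u.
Proof. by apply: sumr_ge0 => i _; exact: sqr_ge0. Qed.

Lemma sqr_norm2 (R : realType) (d : nat) (u : 'cV[R]_d) :
  norm2 u ^+ 2 = dot u u.
Proof. by rewrite sqr_sqrtr ?dot_ge0. Qed.

Lemma norm2_gt0 (R : realType) (d : nat) (u : 'cV[R]_d) :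
  u != 0 -> 0 < norm2 u.
Proof.
move=> u0; rewrite sqrtr_gt0 lt_neqAle dot_ge0 andbT eq_sym.
by apply: contra u0 => /eqP/dot_eq0 ->.
Qed.

Lemma coord_le_norm2 (R : realType) (d : nat) (u : 'cV[R]_d) i :
  `|u i 0| <= norm2 u.
Proof.
rewrite -(@ler_pXn2r _ 2)// ?nnegrE ?norm2_ge0// sqr_norm2 real_normK ?num_real//.
rewrite /dot (bigD1 i)//= expr2 lerDl.
by apply: sumr_ge0 => j _; exact: sqr_ge0.
Qed.

Lemma dot_trmx_mul (R : realType) (n d : nat) (A : 'M[R]_(n, d))
    (u : 'cV[R]_n) (v : 'cV[R]_d) : dot (A^T *m u) v = dot u (A *m v).
Proof.
have dotE k (x y : 'cV[R]_k) : dot x y = (x^T *m y) 0 0.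
  by rewrite mxE; apply: eq_bigr => i _; rewrite mxE.
by rewrite !dotE trmx_mul trmxK mulmxA.
Qed.

(** Pythagoras: orthogonality kills both cross terms of [dot u u]. *)
Lemma norm2_eproj_le (R : realType) (d : nat) (M : {vspace 'cV[R]_d})
    (u : 'cV[R]_d) : norm2 (eproj M u) <= norm2 u.
Proof.
rewrite ler_sqrt ?dot_ge0// [in leRHS](eproj_decomp M u).
have /mem_orthP/(_ _ (eproj_mem M u)) o := eproj_mem (orth M) u.
rewrite !dotDl !(dotC _ (_ + _)) !dotDl o (dotC _ (eproj (orth M) u)) o.
by rewrite addr0 add0r lerDl dot_ge0.
Qed.

(** * Norm equivalence in finite dimension, Hoelder's inequality, subspace Lipschitz constant *)

Section Norm.
Context {R : realType} {d : nat} {N : 'cV[R]_d -> R}.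
Hypothesis normN : is_norm N.
Implicit Types u v : 'cV[R]_d.

Let ler_N_D u v : N (u + v) <= N u + N v.
Proof. by case: normN. Qed.

Let NZ a u : N (a *: u) = `|a| * N u.
Proof. by case: normN. Qed.

Lemma is_norm0 : N 0 = 0.
Proof. by rewrite -(scale0r 0) NZ normr0 mul0r. Qed.

Lemma is_normN u : N (- u) = N u.
Proof. by rewrite -scaleN1r NZ normrN1 mul1r. Qed.

Lemma is_norm_ge0 u : 0 <= N u.
Proof.
have := ler_N_D u (- u); rewrite subrr is_norm0 is_normN.
by rewrite -mulr2n pmulrn_lge0.
Qed.

Lemma is_norm_gt0 u : u != 0 -> 0 < N u.
Proof.
move=> u0; rewrite lt_neqAle is_norm_ge0 andbT eq_sym.
by apply: contra u0; case: normN => _ _ N0 /eqP/N0 ->.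
Qed.

(** Expand [u] in the canonical basis. This half of norm equivalence yields the continuity of [N]
    and the boundedness of the ratios in [sub_lip]. *)
Lemma is_norm_le_sum u (c : R) : (forall i, `|u i 0| <= c) ->
  N u <= c * \sum_(i < d) N (delta_mx i 0).
Proof.
move=> uc; rewrite {1}[u]matrix_sum_delta mulr_sumr.
elim/big_ind2: _ => [|x1 x2 y1 y2 h1 h2|i _]; first by rewrite is_norm0.
  by rewrite (le_trans (ler_N_D _ _))// lerD.
by rewrite big_ord1 NZ ler_wpM2r ?is_norm_ge0.
Qed.

Lemma is_norm_lip u v : `|N u - N v| <= N (u - v).
Proof.
rewrite ler_norml; apply/andP; split.
  rewrite lerNl opprB lerBlDr -(is_normN (u - v)) opprB.
  by rewrite -[in leLHS](subrK u v) ler_N_D.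
by rewrite lerBlDr -[in leLHS](subrK v u) ler_N_D.
Qed.

Let coord_le_mx_norm (x : 'rV[R]_d) i : `|x 0 i| <= `|x|.
Proof.
rewrite [leRHS]/Num.Def.normr/= mx_normrE.
by apply: (le_bigmax _ (fun ij => `|x ij.1 ij.2|) (0, i)).
Qed.

Lemma is_norm_continuous : continuous (fun x : 'rV[R]_d => N x^T).
Proof.
set K := \sum_(i < d) N (delta_mx i 0).
have K0 : 0 <= K by apply: sumr_ge0 => i _; exact: is_norm_ge0.
move=> x; apply/(@cvgrPdist_le _ _ _ (nbhs x)) => e e0.
(* The [+ 1] keeps the denominator positive when [K = 0], as happens for [d = 0]. *)
have eK : 0 < e / (K + 1) by rewrite divr_gt0// ltr_wpDl.
apply/nbhs_ballP; exists (e / (K + 1)) => //= y.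
rewrite mx_norm_ball => /ltW xy.
rewrite (le_trans (is_norm_lip _ _))// -linearB/=.
apply: (@le_trans _ _ (e / (K + 1) * K)).
  apply: is_norm_le_sum => i; rewrite mxE (le_trans _ xy)//.
by rewrite mulrAC ler_pdivrMr ?ltr_wpDl// ler_pM2l// lerDl.
Qed.

(** By compactness, [N] attains a positive minimum on the sup-norm unit sphere; homogeneity extends
    the bound to all vectors. This is what bounds the set in [dual_norm]. *)
Lemma is_norm_coord_bound : exists2 c, 0 < c & forall u i, c * `|u i 0| <= N u.
Proof.
pose S : set 'rV[R]_d := [set x | `|x| = 1].
(* Without a nonzero vector the sphere is empty and has no minimizer, but then [u = 0]. *)
have [[z z0]|S0] := pselect (exists z : 'rV[R]_d, z != 0); last first.
  exists 1 => // u i; have -> : u = 0.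
    apply: contra_notP S0 => /eqP u0; exists u^T.
    by apply: contra u0 => /eqP u0; rewrite -[u]trmxK u0 trmx0.
  by rewrite mxE normr0 mulr0 is_norm0.
have nz x : x != 0 -> S (`|x|^-1 *: x).
  by move=> x0; rewrite /S/= normrZ normfV normr_id mulVf ?normr_eq0.
have Sne : S !=set0 by exists (`|z|^-1 *: z); exact: nz.
have cS : compact S.
  apply: bounded_closed_compact.
    by exists 1; split=> // M M1 x /= ->; exact: ltW.
  apply: (@preimage_closed _ _ (fun x : 'rV[R]_d => `|x|) [set x | x = 1]).
    by move=> x _; exact: norm_continuous.
  exact: closed_eq.
have [c cS' cmin] := @EVT_min_rV _ _ _ _ Sne cS
  (continuous_subspaceT is_norm_continuous).
have c0 : 0 < N c^T.
  apply: is_norm_gt0; apply/eqP => /(congr1 trmx); rewrite trmxK trmx0 => c0.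
  by move: cS'; rewrite inE /S/= c0 normr0 => /esym/eqP; rewrite oner_eq0.
exists (N c^T) => // u i.
have [->|u0] := eqVneq u 0; first by rewrite mxE normr0 mulr0 is_norm_ge0.
have uT0 : u^T != 0.
  by apply: contra u0 => /eqP h; rewrite -[u]trmxK h trmx0.
have := cmin _ (mem_set (nz _ uT0)).
rewrite linearZ/= trmxK NZ normfV normr_id mulrC ler_pdivlMr ?normr_gt0//.
apply: le_trans; rewrite ler_pM2l//.
by have := coord_le_mx_norm u^T i; rewrite mxE.
Qed.

(** Test the supremum at [v] divided by [N v]. A [sup] dominates its set only if the set is bounded
    above; here every coordinate on the unit ball of [N] is at most [1 / c]. *)
Lemma dot_le_dual_norm u v : dot u v <= dual_norm N u * N v.
Proof.
have [->|v0] := eqVneq v 0.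
  rewrite is_norm0 mulr0 /dot big1// => i _; by rewrite mxE mulr0.
have Nv := is_norm_gt0 v0.
rewrite -ler_pdivrMr// mulrC dotC -dotZl dotC; apply: ub_le_sup; last first.
  exists ((N v)^-1 *: v) => //=.
  by rewrite NZ gtr0_norm ?invr_gt0// mulVf ?gt_eqF.
have [c c0 cN] := is_norm_coord_bound.
exists (\sum_(i < d) `|u i 0| / c) => _ [w /= w1 <-].
apply: ler_sum => i _; rewrite (le_trans (ler_norm _))// normrM.
rewrite ler_wpM2l// -[leRHS]mul1r ler_pdivlMr// mulrC.
exact: le_trans (cN _ _) w1.
Qed.

Lemma is_norm_le_sub_lip (M : {vspace 'cV[R]_d}) u :
  u \in M -> N u <= sub_lip N M * norm2 u.
Proof.
move=> uM; have [->|u0] := eqVneq u 0.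
  by rewrite is_norm0 /norm2 /dot big1 ?sqrtr0 ?mulr0// => i _; rewrite mxE mulr0.
rewrite -ler_pdivrMr ?norm2_gt0//; apply: ub_le_sup; last by exists u.
exists (\sum_(i < d) N (delta_mx i 0)) => _ [v /= [_ v0] <-].
rewrite ler_pdivrMr ?norm2_gt0// mulrC; apply: is_norm_le_sum => i.
exact: coord_le_norm2.
Qed.

Lemma sub_lip_ge0 (M : {vspace 'cV[R]_d}) : 0 <= sub_lip N M.
Proof.
have [[u [uM u0]]|M0] := pselect (exists u, u \in M /\ u != 0).
  rewrite -(pmulr_lge0 _ (norm2_gt0 u0)).
  exact: le_trans (is_norm_ge0 u) (is_norm_le_sub_lip uM).
rewrite /sub_lip (_ : [set _ | _ in _] = set0) ?sup0//.
by apply/seteqP; split => // v [u uM _]; apply: M0; exists u.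
Qed.

End Norm.

(** * Scalar inequalities *)

(** Here [s] stands for the square root of the curvature and [m] for [N Delta]. The cone condition
    gives [m <= 7 * Psi * delta + 4 * K], whence the factor [7 / 32] after multiplication by
    [tau]. *)
Lemma error_sqr_le (R : realFieldType)
    (s delta Psi tau lambda K a b m : R) :
  0 < s -> 0 <= delta -> 0 <= tau -> 0 < lambda ->
  a <= Psi * delta -> 0 <= m -> m <= a + b -> b <= 6 * a + 4 * K ->
  tau * Psi <= s / 32 ->
  s ^+ 2 / 2 * delta ^+ 2 - tau ^+ 2 * m ^+ 2 <= lambda * (3 / 2 * a + K) ->
  s ^+ 2 * delta ^+ 2
    <= 128 * (tau * K) ^+ 2 + 4 * (lambda * K) + 18 * (lambda * Psi / s) ^+ 2.
Proof.
move=> s0 d0 t0 l0 aP m0 mab bK tP rsc.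
have tm : tau * m <= 7 / 32 * (s * delta) + 4 * (tau * K).
  have m7 : m <= 7 * (Psi * delta) + 4 * K by lra.
  have := ler_wpM2l t0 m7; have := ler_wpM2r d0 tP; lra.
have tm2 : (tau * m) ^+ 2 <= (7 / 32 * (s * delta) + 4 * (tau * K)) ^+ 2.
  by rewrite ler_sqr ?nnegrE// ?(le_trans _ tm)// mulr_ge0.
have la : lambda * a <= (lambda * Psi / s) * (s * delta).
  rewrite (_ : _ * (s * delta) = lambda * (Psi * delta)).
    by rewrite ler_wpM2l// ltW.
  by field; rewrite gt_eqF.
move: rsc; rewrite (_ : s ^+ 2 / 2 * _ = (s ^+ 2 * delta ^+ 2) / 2); last by field.
rewrite -!exprMn => rsc.
(* With [x], [y], [g] as named below, these squares split the cross terms in [x * y] and [g * x].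
   After multiplying [rsc] by 4, the left side [2 * x ^+ 2] absorbs [49 / 128 * x ^+ 2] from the
   tolerance and [x ^+ 2 / 2] from [6 * g * x], leaving more than [x ^+ 2]. *)
have := sqr_ge0 (s * delta - 6 * (lambda * Psi / s)).
have := sqr_ge0 (7 / 32 * (s * delta) - 4 * (tau * K)).
have := sqr_ge0 (s * delta).
move: tm2 la rsc.
move: (s * delta) (tau * m) (tau * K) (lambda * Psi / s) => x t y g.
lra.
Qed.

(** The square of a sum of three terms is at most three times the sum of their squares; [1 <= D]
    then puts a common factor [D ^+ 2] in front. *)
Lemma slack_sqr_le (R : realFieldType) (D p q c1 c2 : R) : 1 <= D ->
  (D * q + c1 * p + c2) ^+ 2
    <= 3 * D ^+ 2 * (q ^+ 2 + (c1 ^+ 2 * p ^+ 2 + c2 ^+ 2)).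
Proof.
move=> D1; rewrite -exprMn; move: (c1 * p) => x.
have D2 : 1 <= D ^+ 2 by rewrite expr_ge1// (le_trans _ D1).
have := sqr_ge0 (D * q - x); have := sqr_ge0 (D * q - c2).
have := sqr_ge0 (x - c2).
have := ler_wpM2r (sqr_ge0 x) D2; have := ler_wpM2r (sqr_ge0 c2) D2.
lra.
Qed.

(** * Error bound for the minimizer *)

Theorem theorem3p11 (R : realType) (B : R) :
  exists C : R, 0 < C /\
  forall (n d : nat) (A : 'M[R]_(n, d)) (ustar : 'cV[R]_d) (eps y : 'cV[R]_n)
    (M : {vspace 'cV[R]_d}) (Reg : R -> 'cV[R]_d -> R) (N : 'cV[R]_d -> R)
    (c1L c2L c1U c2U : R -> R) (lambda eta kappa tau : R) (uhat : 'cV[R]_d),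
  (0 < n)%N ->
  y = A *m ustar + eps ->
  approx_decomposable Reg M N c1L c2L c1U c2U ->
  0 < lambda ->
  0 < eta -> c1L eta < 1 / 4 -> c1U eta <= B ->
  (forall u : 'cV[R]_d,
    objective A y lambda (Reg eta) uhat <= objective A y lambda (Reg eta) u) ->
  0 < kappa -> 0 <= tau -> RSC A N kappa tau ->
  tau * sub_lip N M <= Num.sqrt kappa / 32 ->
  2 * dual_norm N (n%:R^-1 *: (A^T *m eps)) <= lambda ->
  let c1 := c1L eta + c1U eta in
  let c2 := c2L eta + c2U eta in
  let NM := N (eproj M ustar) in
  let NMperp := N (eproj (orth M) ustar) in
  let E := tau ^+ 2 / kappa * (c1 ^+ 2 * NM ^+ 2 + c2 ^+ 2)
           + lambda / kappa * (c1 * NM + c2) in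
  norm2 (uhat - ustar) ^+ 2
    <= C * (lambda ^+ 2 / kappa ^+ 2 * sub_lip N M ^+ 2
            + tau ^+ 2 / kappa * NMperp ^+ 2
            + lambda / kappa * NMperp
            + E).
Proof.
(* [D] bounds the coefficient [2 + c1U eta - c1L eta] that [NMperp] receives in [reg_diff]; the
   absolute value gives [2 <= D] for any sign of [B]. *)
set D := 2 + `|B|.
have D2 : 2 <= D by rewrite lerDl.
have D1 : 1 <= D by lra.
(* [384 = 128 * 3], from [error_sqr_le] and [slack_sqr_le]; the other constants, 4 and 18, are
   smaller. *)
exists (384 * D ^+ 2); split; first by rewrite mulr_gt0// exprn_gt0; lra.
move=> n d A ustar eps y M Reg N c1L c2L c1U c2U lambda eta kappa tau uhat.
move=> n0 -> [_ [normN decN] c_ge0 _ RegN] l0 eta0 c1L4 c1UB.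
move=> uhat_min kappa0 tau0 rsc tauPsi lambdaN; cbv zeta.
set c1 := c1L eta + c1U eta; set c2 := c2L eta + c2U eta.
set NM := N (eproj M ustar); set NMperp := N (eproj (orth M) ustar).
have [c1L0 c2L0 c1U0 c2U0] := c_ge0 _ eta0.
set Delta := uhat - ustar.
set Psi := sub_lip N M in tauPsi *.
set a := N (eproj M Delta).
set b := N (eproj (orth M) Delta).
have decE u : N u = N (eproj M u) + N (eproj (orth M) u).
  by rewrite {1}(eproj_decomp M u) decN// eproj_mem.
have NM0 : 0 <= NM := is_norm_ge0 normN _.
have Np0 : 0 <= NMperp := is_norm_ge0 normN _.
have a0 : 0 <= a := is_norm_ge0 normN _.
have b0 : 0 <= b := is_norm_ge0 normN _.
have Psi0 : 0 <= Psi := sub_lip_ge0 normN M.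
have d0 : 0 <= norm2 Delta := norm2_ge0 _.
have aPsi : a <= Psi * norm2 Delta.
  rewrite (le_trans (is_norm_le_sub_lip normN (eproj_mem M Delta)))//.
  by rewrite ler_wpM2l// norm2_eproj_le.
(* Decomposability applies to the mixed vector made of the [M] part of [ustar] and the orthogonal
   part of [Delta], which differs from [uhat] by the two remaining parts. *)
have Nuhat : NM + b <= N uhat + (NMperp + a).
  rewrite -(decN _ _ (eproj_mem M ustar) (eproj_mem (orth M) Delta)).
  have -> : eproj M ustar + eproj (orth M) Delta
      = uhat - (eproj (orth M) ustar + eproj M Delta).
    by apply/eqP; rewrite eq_sym subr_eq addrACA
      (addrC (eproj (orth M) Delta)) -!eproj_decomp addrC subrK.
  case: (normN) => tri _ _; rewrite (le_trans (tri _ _))// is_normN// lerD2l.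
  exact: tri.
have reg_diff : Reg eta ustar - Reg eta uhat
    <= D * NMperp + c1 * NM + c2 + a - 3 / 4 * b.
  have /andP[_ ub] := RegN _ ustar eta0.
  have /andP[lb _] := RegN _ uhat eta0.
  have c1UD : c1U eta * NMperp <= `|B| * NMperp.
    by rewrite ler_wpM2r// (le_trans c1UB)// ler_norm.
  (* [c1L eta < 1 / 4] makes this factor nonnegative and, through [h3], leaves [b] with coefficient
     at most [- 3 / 4]. *)
  have lb' : (1 - c1L eta) * (NM + b - NMperp - a) <= (1 - c1L eta) * N uhat.
    by rewrite ler_wpM2l; lra.
  have h1 : 0 <= c1L eta * NMperp by rewrite mulr_ge0.
  have h2 : 0 <= c1L eta * a by rewrite mulr_ge0.
  have h3 : 0 <= (1 / 4 - c1L eta) * b by rewrite mulr_ge0//; lra.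
  rewrite decE -/NM -/NMperp in ub; rewrite /D /c1 /c2.
  move: ub lb c1UD lb' h1 h2 h3; lra.
set K := D * NMperp + c1 * NM + c2 in reg_diff.
have K0 : 0 <= K by rewrite !addr_ge0// mulr_ge0// ?addr_ge0//; lra.
have loss_le : norm2 (A *m Delta) ^+ 2 / (2 * n%:R)
    <= lambda * (3 / 2 * a - 1 / 4 * b + K).
  (* The noise term costs half of [lambda * (a + b)], turning the coefficients [1] and [- 3 / 4]
     into [3 / 2] and [- 1 / 4]. *)
  have dual : dot eps (A *m Delta) / n%:R <= lambda / 2 * (a + b).
    rewrite mulrC -dot_trmx_mul -dotZl -decE.
    apply: (le_trans (dot_le_dual_norm normN _ _)).
    by rewrite ler_wpM2r ?is_norm_ge0//; lra.
  have := uhat_min ustar; rewrite /objective.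
  have -> : A *m ustar + eps - A *m uhat = eps - A *m Delta.
    by rewrite mulmxBr opprB addrAC addrC addrA.
  rewrite addrAC subrr add0r !sqr_norm2 => min.
  have lr : lambda * (Reg eta ustar - Reg eta uhat)
      <= lambda * (K + a - 3 / 4 * b) by rewrite ler_wpM2l ?(ltW l0)//.
  have expand : dot (eps - A *m Delta) (eps - A *m Delta) / (2 * n%:R)
      = dot eps eps / (2 * n%:R) + dot (A *m Delta) (A *m Delta) / (2 * n%:R)
        - dot eps (A *m Delta) / n%:R.
    rewrite -scaleN1r !dotDl !dotZl !(dotC _ (eps + _)) !dotDl !dotZl.
    rewrite (dotC (A *m Delta) eps); field.
    by rewrite pnatr_eq0 -lt0n.
  by move: min lr dual; rewrite expand; lra.
(* The loss is nonnegative, so dividing [loss_le] by [lambda] leaves the cone condition. *)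
have b6 : b <= 6 * a + 4 * K.
  have loss0 : 0 <= norm2 (A *m Delta) ^+ 2 / (2 * n%:R).
    by rewrite divr_ge0 ?sqr_ge0 ?mulr_ge0 ?ler0n.
  have := le_trans loss0 loss_le.
  by rewrite pmulr_rge0//; lra.
have s0 : 0 < Num.sqrt kappa by rewrite sqrtr_gt0.
have NDelta : N Delta <= a + b by rewrite decE.
have rscD : Num.sqrt kappa ^+ 2 / 2 * norm2 Delta ^+ 2
    - tau ^+ 2 * N Delta ^+ 2 <= lambda * (3 / 2 * a + K).
  rewrite sqr_sqrtr ?(ltW kappa0)// (le_trans (rsc _))// (le_trans loss_le)//.
  by rewrite ler_wpM2l ?(ltW l0)//; lra.
have := error_sqr_le s0 d0 tau0 l0 aPsi (is_norm_ge0 normN Delta)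
  NDelta b6 tauPsi rscD.
rewrite !exprMn exprVn sqr_sqrtr ?(ltW kappa0)// => final.
rewrite -(ler_pM2l kappa0) (le_trans final)//.
(* The target is regrouped to match [final] term by term: squared slack, linear slack, and the [Psi]
   term. *)
rewrite (_ : kappa * _ = 128 * (tau ^+ 2 * (3 * D ^+ 2 * (NMperp ^+ 2
      + (c1 ^+ 2 * NM ^+ 2 + c2 ^+ 2))))
    + 384 * (lambda * (D ^+ 2 * (NMperp + (c1 * NM + c2))))
    + 384 * (D ^+ 2 * (lambda ^+ 2 * Psi ^+ 2 / kappa))); last first.
  by field; rewrite gt_eqF.
have K2 : tau ^+ 2 * K ^+ 2 <= tau ^+ 2 * (3 * D ^+ 2 * (NMperp ^+ 2
    + (c1 ^+ 2 * NM ^+ 2 + c2 ^+ 2))).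
  by rewrite ler_wpM2l ?sqr_ge0// slack_sqr_le.
(* The linear slack only needs one factor [D]; it is weakened to share the constant [D ^+ 2]. *)
have DD : D <= D ^+ 2 by rewrite expr2 ler_peMl//; lra.
have c1NM0 : 0 <= c1 * NM by rewrite mulr_ge0// addr_ge0.
have c20 : 0 <= c2 by rewrite addr_ge0.
have K1 : lambda * K <= lambda * (D ^+ 2 * (NMperp + (c1 * NM + c2))).
  rewrite ler_wpM2l ?(ltW l0)// /K -addrA mulrDr lerD ?ler_wpM2r//.
  by rewrite ler_peMl ?addr_ge0//; lra.
have g0 : 0 <= lambda ^+ 2 * Psi ^+ 2 / kappa.
  by rewrite divr_ge0 ?mulr_ge0 ?sqr_ge0// ltW.
have g1 : lambda ^+ 2 * Psi ^+ 2 / kappa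
    <= D ^+ 2 * (lambda ^+ 2 * Psi ^+ 2 / kappa) by rewrite ler_peMl//; lra.
have lK0 : 0 <= lambda * K by rewrite mulr_ge0// ltW.
lra.
Qed.
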